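(* Let $r\ge 2$, $n\ge 1$ be integers, let $\rho_1,\ldots,\rho_r$ be quantum states on a common space, and let $z\ge 1/2$. Then the average pairwise $z$-fidelity is super-multiplicative: $$\left(F_z(\rho_1,\ldots,\rho_r)\right)^n\le F_z\left(\rho_1^{\otimes n},\ldots,\rho_r^{\otimes n}\right).$$
   Context: A quantum state is a positive semi-definite operator of unit trace on a finite-dimensional complex Hilbert space. For $z\ge1/2$, $F_z(\rho,\sigma)=\operatorname{Tr}\big[(\sigma^{1/(4z)}\rho^{1/(2z)}\sigma^{1/(4z)})^z\big]$ for two states, and the average pairwise $z$-fidelity is $F_z(\rho_1,\ldots,\rho_r)=\frac{2}{r(r-1)}\sum_{1\le i<j\le r}F_z(\rho_i,\rho_j)$. *)

(* Defs.v *)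
From HB Require Import structures.
From mathcomp Require Import all_boot all_order all_algebra.
From mathcomp Require Import sesquilinear spectral.
From mathcomp Require Import complex.
From mathcomp Require mxtens.
From mathcomp Require Import reals exp.

Set Implicit Arguments.
Unset Strict Implicit.
Unset Printing Implicit Defensive.

Import Order.TTheory GRing.Theory Num.Theory.

Local Open Scope ring_scope.
Local Open Scope complex_scope.
Local Open Scope sesquilinear_scope.

(* Operators on the Hilbert space C^d are d x d matrices over R[i]. *)

(* The order of R[i] makes [0 <= x] include the condition that x is real. *)
Definition is_psd (R : realType) (d : nat) (A : 'M[R[i]]_d) : Prop :=
  A \is hermsymmx /\ forall v : 'cV[R[i]]_d, 0 <= (v ^t* *m A *m v) 0 0.

Definition is_state (R : realType) (d : nat) (A : 'M[R[i]]_d) : Prop :=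
  is_psd A /\ \tr A = 1.

(* Functional calculus: with A = U^-1 D U, U = spectralmx A unitary and
   D = diag (spectral_diag A), the power A^s is U^-1 D^s U.  It is meaningful
   only for positive semi-definite A, where the eigenvalues are nonnegative reals
   (so taking [complex.Re] loses nothing); for s > 0, powR gives 0^s = 0. *)
Definition mxpowR (R : realType) (d : nat) (A : 'M[R[i]]_d) (s : R) :
    'M[R[i]]_d :=
  invmx (spectralmx A)
  *m diag_mx (map_mx (fun x : R[i] => (powR (complex.Re x) s)%:C)
                     (spectral_diag A))
  *m spectralmx A.

Definition zfidelity (R : realType) (d : nat) (z : R) (rho sigma : 'M[R[i]]_d) :
    R[i] :=
  \tr (mxpowR (mxpowR sigma (4 * z)^-1 *m mxpowR rho (2 * z)^-1
               *m mxpowR sigma (4 * z)^-1) z).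

Definition avg_zfidelity (R : realType) (d r : nat) (z : R)
    (rho : 'I_r -> 'M[R[i]]_d) : R[i] :=
  2 / (r%:R * (r%:R - 1))
  * \sum_(i < r) \sum_(j < r | (i < j)%N) zfidelity z (rho i) (rho j).

(* The n-fold Kronecker power, acting on C^(d ^ n). *)
Definition tensor_power (R : realType) (d : nat) (A : 'M[R[i]]_d) (n : nat) :
    'M[R[i]]_(d ^ n) :=
  mxtens.ntensmx A n.

(* Main.v *)
(* Real powers of positive semi-definite matrices commute with Kronecker products,
   because a unitary diagonalization of A (x) B is the Kronecker product of unitary
   diagonalizations of A and B.  Hence the z-fidelity is multiplicative,
   F_z(rho^(x)n, sigma^(x)n) = F_z(rho, sigma)^n, and the claim is Jensen's
   inequality for x |-> x^n applied to the r(r-1)/2 pairwise fidelities. *)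
Require Import Defs.
From mathcomp Require Import all_boot all_order all_algebra.
From mathcomp Require Import sesquilinear spectral.
From mathcomp Require Import complex reals exp mxtens.
From mathcomp Require Import ring.

Import Order.TTheory GRing.Theory Num.Theory.
Local Open Scope ring_scope.
Local Open Scope complex_scope.

(* f applied to the eigenvalues does not depend on the diagonalization: W = U V^-1
   satisfies a_i W_ij = W_ij b_j, so a_i = b_j wherever W_ij != 0. *)
Lemma diag_mx_functional_calculus (F : fieldType) (d : nat) (f : F -> F)
    (U V : 'M[F]_d) (a b : 'rV[F]_d) (hU : U \in unitmx) (hV : V \in unitmx) :
  invmx U *m diag_mx a *m U = invmx V *m diag_mx b *m V ->
  invmx U *m diag_mx (map_mx f a) *m U = invmx V *m diag_mx (map_mx f b) *m V.
Proof.
move=> eqUV; pose W := U *m invmx V.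
have intertwine : diag_mx a *m W = W *m diag_mx b.
  have -> : diag_mx a *m W = U *m (invmx U *m diag_mx a *m U) *m invmx V.
    by rewrite /W !mulmxA mulmxV // mul1mx.
  by rewrite eqUV !mulmxA mulmxK.
have intertwine_f (M : 'M[F]_d) : diag_mx a *m M = M *m diag_mx b ->
    diag_mx (map_mx f a) *m M = M *m diag_mx (map_mx f b).
  move=> intertwine_M; apply/matrixP => i j; rewrite mul_diag_mx mul_mx_diag !mxE.
  have := congr1 (fun N : 'M_d => N i j) intertwine_M.
  rewrite mul_diag_mx mul_mx_diag !mxE /= => Mij.
  have [-> | M0] := eqVneq (M i j) 0; first by rewrite mulr0 mul0r.
  by rewrite mulrC; congr (_ * f _); apply: (mulfI M0); rewrite -Mij mulrC.
have UW : invmx U *m W = invmx V by rewrite /W mulKmx.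
have WV : W *m V = U by rewrite /W mulmxKV.
by rewrite -{2}WV mulmxA -(mulmxA (invmx U)) (intertwine_f W) // mulmxA UW.
Qed.

Lemma mxtrace_tens (K : comNzRingType) (m n : nat) (A : 'M[K]_m) (B : 'M[K]_n) :
  \tr (A *t B) = \tr A * \tr B.
Proof.
by rewrite /mxtrace mulr_sum; apply: eq_bigr => i _; rewrite mxE.
Qed.

Lemma tens1mx (K : comNzRingType) (m n : nat) : (1%:M : 'M[K]_m) *t (1%:M : 'M[K]_n) = 1%:M.
Proof.
apply/matrixP => i j; case: (mxtens_indexP i) => i1 i2.
case: (mxtens_indexP j) => j1 j2; rewrite tensmxE !mxE -natrM mulnb.
by rewrite (can_eq (@mxtens_indexK _ _)) xpair_eqE.
Qed.

(** The spectrum of a Kronecker product: each eigenvalue of one factor times each of the other, in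
    the index order of [*t]. *)
Definition row_tens {K : comNzRingType} {m n : nat} (a : 'rV[K]_m) (b : 'rV[K]_n) : 'rV[K]_(m * n) :=
  \row_k (a 0 (mxtens_unindex k).1 * b 0 (mxtens_unindex k).2).

Lemma diag_mx_tens (K : comNzRingType) (m n : nat) (a : 'rV[K]_m) (b : 'rV[K]_n) :
  diag_mx a *t diag_mx b = diag_mx (row_tens a b).
Proof.
apply/matrixP => i j; case: (mxtens_indexP i) => i1 i2.
case: (mxtens_indexP j) => j1 j2; rewrite tensmxE !mxE !mxtens_indexK.
rewrite (can_eq (@mxtens_indexK _ _)) xpair_eqE.
by case: eqP; case: eqP => //=; rewrite ?mulr0 ?mul0r.
Qed.

Section FunctionalCalculus.
Local Open Scope sesquilinear_scope.

Variable R : realType.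
Local Notation C := R[i].

Definition cpowR (s : R) (x : C) : C := (powR (complex.Re x) s)%:C.

Lemma cpowR_ge0 (s : R) (x : C) : 0 <= cpowR s x.
Proof. by rewrite /cpowR ler0c powR_ge0. Qed.

(** In the order of [R[i]], nonnegativity kills the imaginary parts, so [complex.Re] is
    multiplicative on [x] and [y]. *)
Lemma cpowRM (s : R) (x y : C) :
  0 <= x -> 0 <= y -> cpowR s (x * y) = cpowR s x * cpowR s y.
Proof.
case: x y => [x x'] [y y']; rewrite !lecE /= => /andP[/eqP -> x0] /andP[/eqP -> y0].
by rewrite /cpowR /= mulr0 subr0 powRM // rmorphM.
Qed.

(** Trades the quadratic form for a free choice of unitary diagonalization; powers and Kronecker
    products are computed in that form. *)
Lemma is_psdP (d : nat) (A : 'M[C]_d) :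
  is_psd A <-> exists (U : 'M[C]_d) (e : 'rV[C]_d),
    [/\ U \is unitarymx, forall i, 0 <= e 0 i & A = invmx U *m diag_mx e *m U].
Proof.
split=> [[Aherm Apos] | [U [e [Uunitary e0 ->]]]].
  have /orthomx_spectralP AE := hermitian_normalmx Aherm.
  have Uunitary := spectral_unitarymx A; have Uunit := spectral_unit A.
  exists (spectralmx A), (spectral_diag A); split=> // i.
  (* This vector is the [i]-th eigenvector, where the form takes the [i]-th eigenvalue as its
     value. *)
  have := Apos (invmx (spectralmx A) *m delta_mx i 0).
  rewrite trmx_mul map_mxM invmx_unitary // trmxCK.
  rewrite -invmx_unitary // !mulmxA [X in _ *m _ *m X *m _ *m _]AE !mulmxA.
  rewrite mulmxK // mulmxK // trmx_delta map_delta_mx -rowE -colE.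
  by rewrite !mxE eqxx mulr1n.
rewrite invmx_unitary //; split.
  apply/is_hermitianmxP; rewrite expr0 scale1r !trmx_mul !map_mxM !mulmxA.
  rewrite trmxCK tr_diag_mx map_diag_mx; congr (_ *m diag_mx _ *m _).
  by apply/rowP => i; rewrite mxE; apply/esym/CrealP/ger0_real.
(* With w = U v, the form is the sum of e_k |w_k|^2. *)
move=> v; rewrite -mulmxA -!mulmxA mulmxA -map_mxM -trmx_mul mul_diag_mx mxE.
apply: sumr_ge0 => i _; rewrite !mxE mulrCA mulr_ge0 //.
by rewrite mulrC mul_conjC_ge0.
Qed.

(** Frees [mxpowR] from the particular [spectralmx] in its definition: the functional calculus gives
    the same result for every diagonalization. *)
Lemma mxpowR_diag (d : nat) (U : 'M[C]_d) (e : 'rV[C]_d) (s : R) :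
  U \is unitarymx ->
  mxpowR (invmx U *m diag_mx e *m U) s
  = invmx U *m diag_mx (map_mx (cpowR s) e) *m U.
Proof.
move=> Uunitary; set A := invmx U *m _ *m _.
have /orthomx_spectralP AE : A \is normalmx.
  by apply/orthomx_spectral_subproof; exists (U, e).
apply: diag_mx_functional_calculus.
- exact: spectral_unit.
- exact: unitarymx_unit.
- by rewrite -AE.
Qed.

Lemma mxpowR_psd (d : nat) (A : 'M[C]_d) (s : R) :
  is_psd A -> is_psd (mxpowR A s).
Proof.
case/is_psdP=> U [e [Uunitary e0 ->]]; rewrite mxpowR_diag //.
by apply/is_psdP; exists U, (map_mx (cpowR s) e); split=> // i; rewrite mxE cpowR_ge0.
Qed.

(** As [S] is its own adjoint, the form at [v] is that of [A] at [S *m v]. *)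
Lemma psd_sandwich (d : nat) (A S : 'M[C]_d) :
  S \is hermsymmx -> is_psd A -> is_psd (S *m A *m S).
Proof.
move=> Sherm [Aherm Apos].
have SE : S ^t* = S by move/is_hermitianmxP: Sherm; rewrite expr0 scale1r => <-.
have AE : A ^t* = A by move/is_hermitianmxP: Aherm; rewrite expr0 scale1r => <-.
split.
  apply/is_hermitianmxP; rewrite expr0 scale1r !trmx_mul !map_mxM.
  by rewrite SE AE mulmxA.
move=> v; have := Apos (S *m v); rewrite trmx_mul map_mxM SE.
by rewrite !mulmxA.
Qed.

Lemma psd_tr_ge0 (d : nat) (A : 'M[C]_d) : is_psd A -> 0 <= \tr A.
Proof.
case/is_psdP=> U [e [Uunitary e0 ->]].
rewrite mxtrace_mulC mulmxA mulmxV ?unitarymx_unit // mul1mx mxtrace_diag.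
exact: sumr_ge0.
Qed.

Lemma unitarymx_tens (m n : nat) (U : 'M[C]_m) (V : 'M[C]_n) :
  U \is unitarymx -> V \is unitarymx -> U *t V \is unitarymx.
Proof.
move=> /unitarymxP hU /unitarymxP hV; apply/unitarymxP.
by rewrite trmx_tens map_mxT tensmx_mul hU hV tens1mx.
Qed.

Lemma tens_diagonalization (m n : nat) (U : 'M[C]_m) (V : 'M[C]_n)
    (a : 'rV[C]_m) (b : 'rV[C]_n) :
  U \is unitarymx -> V \is unitarymx ->
  (invmx U *m diag_mx a *m U) *t (invmx V *m diag_mx b *m V)
  = invmx (U *t V) *m diag_mx (row_tens a b) *m (U *t V).
Proof.
(* Inverses become conjugate transposes, which distribute over [*t]. *)
move=> hU hV; rewrite !invmx_unitary ?unitarymx_tens //.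
by rewrite trmx_tens map_mxT -diag_mx_tens !tensmx_mul.
Qed.

Lemma psd_tens (m n : nat) (A : 'M[C]_m) (B : 'M[C]_n) :
  is_psd A -> is_psd B -> is_psd (A *t B).
Proof.
case/is_psdP=> U [a [hU a0 ->]] /is_psdP[V [b [hV b0 ->]]].
rewrite tens_diagonalization //; apply/is_psdP.
exists (U *t V), (row_tens a b); split=> //; first exact: unitarymx_tens.
by move=> i; rewrite mxE mulr_ge0.
Qed.

Lemma mxpowR_tens (m n : nat) (A : 'M[C]_m) (B : 'M[C]_n) (s : R) :
  is_psd A -> is_psd B -> mxpowR (A *t B) s = mxpowR A s *t mxpowR B s.
Proof.
case/is_psdP=> U [a [hU a0 ->]] /is_psdP[V [b [hV b0 ->]]].
rewrite tens_diagonalization // !mxpowR_diag ?unitarymx_tens //.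
rewrite tens_diagonalization //; congr (_ *m diag_mx _ *m _).
by apply/rowP => i; rewrite !mxE cpowRM.
Qed.

(** Makes the outer power [z] in [zfidelity] amenable to the results on powers of positive
    semi-definite matrices. *)
Lemma zfidelity_core_psd (d : nat) (s t : R) (rho sigma : 'M[C]_d) :
  is_psd rho -> is_psd sigma ->
  is_psd (mxpowR sigma s *m mxpowR rho t *m mxpowR sigma s).
Proof.
move=> hrho hsigma; apply: psd_sandwich; last exact: mxpowR_psd.
by case: (mxpowR_psd _ _ s hsigma).
Qed.

Lemma zfidelity_ge0 (d : nat) (z : R) (rho sigma : 'M[C]_d) :
  is_psd rho -> is_psd sigma -> 0 <= zfidelity z rho sigma.
Proof. by move=> ? ?; apply/psd_tr_ge0/mxpowR_psd/zfidelity_core_psd. Qed.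

Lemma zfidelity_tens (m n : nat) (z : R)
    (rho sigma : 'M[C]_m) (rho' sigma' : 'M[C]_n) :
  is_psd rho -> is_psd sigma -> is_psd rho' -> is_psd sigma' ->
  zfidelity z (rho *t rho') (sigma *t sigma')
  = zfidelity z rho sigma * zfidelity z rho' sigma'.
Proof.
move=> hr hs hr' hs'; rewrite /zfidelity -mxtrace_tens !mxpowR_tens //.
by rewrite !tensmx_mul mxpowR_tens //; apply: zfidelity_core_psd.
Qed.

(** Counting from [n.+1] starts the induction at the first power, which is [A] itself by
    computation. *)
Lemma tensor_power_psd (d n : nat) (A : 'M[C]_d) :
  is_psd A -> is_psd (tensor_power A n.+1).
Proof. by move=> hA; elim: n => [//|n IHn]; apply: psd_tens. Qed.

Lemma zfidelity_tensor_power (d n : nat) (z : R) (rho sigma : 'M[C]_d) :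
  is_psd rho -> is_psd sigma ->
  zfidelity z (tensor_power rho n.+1) (tensor_power sigma n.+1)
  = zfidelity z rho sigma ^+ n.+1.
Proof.
move=> hr hs; elim: n => [//|n IHn]; rewrite exprS -IHn.
by apply: zfidelity_tens => //; apply: tensor_power_psd.
Qed.

End FunctionalCalculus.

(** Convexity of the power function without derivatives: its tangent at [m] stays below it, by
    induction on the exponent. *)
Lemma exprn_ge_tangent (F : numDomainType) (x m : F) (n : nat) :
  0 <= x -> 0 <= m -> m ^+ n.+1 + n.+1%:R * m ^+ n * (x - m) <= x ^+ n.+1.
Proof.
move=> x0 m0; elim: n => [|n IHn].
  by rewrite !expr1 expr0 !mul1r addrC subrK.
rewrite (exprS x) -subr_ge0; have := ler_wpM2l x0 IHn; rewrite -subr_ge0.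
set X := x * x ^+ n.+1 => hX.
(* The new gap is [x] times the previous gap plus a nonnegative multiple of a square. *)
rewrite (_ : _ - _ = X - x * (m ^+ n.+1 + n.+1%:R * m ^+ n * (x - m))
                       + n.+1%:R * m ^+ n * (x - m) ^+ 2).
  rewrite addr_ge0 // mulr_ge0 //; first by rewrite mulr_ge0 ?exprn_ge0.
  (* The order may be partial, as on [R[i]], so the square is nonnegative only because [x - m] is
     real. *)
  by rewrite real_exprn_even_ge0 // rpredB // ger0_real.
by rewrite !exprS -[n.+2%:R]natr1; ring.
Qed.

Lemma power_mean (F : numFieldType) (I : finType) (P : pred I) (f : I -> F)
    (n : nat) : (0 < #|P|)%N -> (forall i, P i -> 0 <= f i) ->
  ((\sum_(i | P i) f i) / #|P|%:R) ^+ n.+1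
  <= (\sum_(i | P i) f i ^+ n.+1) / #|P|%:R.
Proof.
move=> P0 f0; set m := _ / _.
have N0 : 0 < #|P|%:R :> F by rewrite ltr0n.
have m0 : 0 <= m by rewrite divr_ge0 ?sumr_ge0 ?(ltW N0).
rewrite ler_pdivlMr // mulr_natr.
(* Summing the tangents at the mean [m] cancels their linear terms. *)
have -> : m ^+ n.+1 *+ #|P|
    = \sum_(i | P i) (m ^+ n.+1 + n.+1%:R * m ^+ n * (f i - m)).
  rewrite big_split /= sumr_const -mulr_sumr sumrB sumr_const.
  by rewrite -[m *+ _]mulr_natr /m mulfVK ?gt_eqF // subrr mulr0 addr0.
by apply: ler_sum => i Pi; apply: exprn_ge_tangent (f0 i Pi) m0.
Qed.

Lemma card_ord_pairs (r : nat) :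
  #|[pred p : 'I_r * 'I_r | (p.1 < p.2)%N]| = 'C(r, 2).
Proof.
rewrite -sum1_card -(pair_big_dep xpredT (fun i j : 'I_r => (i < j)%N) (fun _ _ => 1%N)) /=.
(* Grouped by the larger index [j], the pairs offer [j] choices of [i]. *)
rewrite (exchange_big_dep xpredT) //= -bin2_sum big_mkord.
apply: eq_bigr => j _.
by rewrite -(big_ord_widen r (fun _ => 1%N)) 1?ltnW // sum_nat_const card_ord muln1.
Qed.

Lemma avg_zfidelityE (R : realType) (d r : nat) (z : R)
    (rho : 'I_r -> 'M[R[i]]_d) : (2 <= r)%N ->
  avg_zfidelity z rho
  = (\sum_(p : 'I_r * 'I_r | (p.1 < p.2)%N) zfidelity z (rho p.1) (rho p.2))
    / #|[pred p : 'I_r * 'I_r | (p.1 < p.2)%N]|%:R.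
Proof.
case: r rho => [//|r] rho hr.
rewrite /avg_zfidelity card_ord_pairs pair_big_dep /= mulrC; congr (_ * _).
(* The normalization 2 / (r (r - 1)) is thus the inverse of the number of pairs. *)
have Cn : ('C(r.+1, 2) * 2)%:R = r.+1%:R * (r.+1%:R - 1) :> R[i].
  by rewrite mulnC -mul_bin_diag bin1 natrM -[in RHS]natr1 addrK natr1.
have C0 : 'C(r.+1, 2)%:R != 0 :> R[i] by rewrite pnatr_eq0 -lt0n bin_gt0.
by rewrite -Cn natrM invfM mulrCA divff ?mulr1 // pnatr_eq0.
Qed.

Theorem mainTheorem4 (R : realType) (r n d : nat) (z : R)
    (rho : 'I_r -> 'M[R[i]]_d)
    (hr : (2 <= r)%N) (hn : (1 <= n)%N)
    (hrho : forall i : 'I_r, is_state (rho i))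
    (hz : 2^-1 <= z) :
  avg_zfidelity z rho ^+ n
    <= avg_zfidelity z (fun i : 'I_r => tensor_power (rho i) n).
Proof.
case: n hn => [//|n] _; rewrite !avg_zfidelityE //.
have psd i : is_psd (rho i) by case: (hrho i).
under [X in _ <= X / _]eq_bigr do rewrite zfidelity_tensor_power //.
(* Fidelities are nonnegative, and [hr] provides at least one pair. *)
apply: power_mean => [|p _]; last exact: zfidelity_ge0.
by rewrite card_ord_pairs bin_gt0.
Qed.
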